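(* Let $A$ be a finite alphabet. Given a distribution $\pi$ (a source over $A$), $\alpha\in(0,1)$ and a code $\varphi$ over $A$, let $T_\varphi^{id}(A,\alpha)$ be the test which, from a sample $x_1\ldots x_t$, accepts $H_0^{id}$ if $$-\log\pi(x_1\ldots x_t)-|\varphi(x_1\ldots x_t)|\le-\log\alpha$$ and rejects $H_0^{id}$ otherwise. Then: i) For each distribution $\pi$, each $\alpha\in(0,1)$ and each code $\varphi$, the Type I error of $T_\varphi^{id}(A,\alpha)$ is not larger than $\alpha$. ii) If, in addition, $\pi$ is a finite-order stationary and ergodic process over $A^\infty$ (i.e. $\pi\in M^*(A)$) and $\varphi$ is a universal code, then the Type II error of $T_\varphi^{id}(A,\alpha)$ goes to $0$ as $t$ tends to infinity.
   Context: $\log=\log_2$ (with $-\log 0=+\infty$). A source over $A$ is a probability measure on $A^\infty$; it is stationary if invariant under the shift, and ergodic if every shift-invariant set has probability 0 or 1. $M_\infty(A)$ is the set of stationary ergodic sources. $M_m(A)\subset M_\infty(A)$, $m\ge0$, is the set of Markov sources of order at most $m$: the conditional distribution of $x_{t+1}$ given the whole past $x_t,x_{t-1},\dots$ depends only on $x_t,\dots,x_{t-m+1}$, for all $t\ge m$. $M^*(A)=\bigcup_{i\ge0}M_i(A)$. Hypotheses: $H_0^{id}$: the sample is generated by $\pi$. $H_1^{id}$: the sample is generated by a stationary and ergodic source over $A$ different from $\pi$. The Type I error is the probability of rejecting $H_0^{id}$ when $H_0^{id}$ is true, i.e. the $\pi$-probability of rejection on samples of length $t$. The Type II error is the probability of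 accepting $H_0^{id}$ when $H_1^{id}$ is true, i.e. the $\tau$-probability of acceptance on samples of length $t$, where $\tau\ne\pi$ is the (fixed) stationary ergodic source generating the sample; ''goes to 0'' is meant for each such $\tau$. A code $\varphi$ over $A$ is a family of maps $\varphi_n:A^n\to\{0,1\}^*$, $n=1,2,\dots$ (one writes $\varphi(u)=\varphi_n(u)$ for $u\in A^n$), such that for each $n$ the map $\varphi_n$ is injective and every concatenation $\varphi_n(u_1)\cdots\varphi_n(u_r)$, $r\ge1$, $u_i\in A^n$, can be uniquely decoded into $u_1\cdots u_r$. $|\varphi(u)|$ is the codeword length. Shannon entropy: $h_m(P)=-\sum_{v\in A^m}P(v)\sum_{a\in A}P(a|v)\log P(a|v)$, $h_\infty(P)=\lim_{m\to\infty}h_m(P)$. A code $\varphi$ is universal if for every stationary ergodic source $P$ over $A$: $\lim_{t\to\infty}|\varphi(x_1\cdots x_t)|/t=h_\infty(P)$ with $P$-probability 1 and $\lim_{t\to\infty}E(|\varphi(x_1\cdots x_t)|)/t=h_\infty(P)$. *)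

(* Defs.v *)
From HB Require Import structures.
From mathcomp Require Import all_boot all_order all_algebra.
From mathcomp Require Import all_classical all_reals all_analysis.

Set Implicit Arguments.
Unset Strict Implicit.
Unset Printing Implicit Defensive.
Import Order.TTheory GRing.Theory Num.Theory.
Import numFieldNormedType.Exports.
Local Open Scope classical_set_scope.
Local Open Scope ring_scope.

(* Finite nonempty alphabets: measurable types are required to be pointed, and
   the sequence space inherits its point from the alphabet. *)
#[short(type="alphabetType")]
HB.structure Definition Alphabet := {A of Finite A & Pointed A}.

(* The generators of the product sigma-algebra. Time is indexed from 0: the
   letter x_{i+1} of the sequence x is [x i]. *)
Definition coordinate_sets (A : alphabetType) : set (set (nat -> A)) :=
  [set E | exists i a, E = [set x | x i = a]].

Definition infseq (A : alphabetType) := g_sigma_algebraType (@coordinate_sets A).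

Definition source (A : alphabetType) (R : realType) := probability (infseq A) R.

Definition shift (A : alphabetType) (x : infseq A) : infseq A := fun i => x i.+1.

Definition sample (A : alphabetType) (x : infseq A) (t : nat) : t.-tuple A :=
  [tuple x i | i < t].

Definition cylinder (A : alphabetType) (t : nat) (u : t.-tuple A) :
  set (infseq A) := [set x | sample x t = u].

Definition stationary (A : alphabetType) (R : realType) (P : source A R) : Prop :=
  forall E, measurable E -> P (@shift A @^-1` E) = P E.

Definition ergodic (A : alphabetType) (R : realType) (P : source A R) : Prop :=
  forall E, measurable E -> @shift A @^-1` E = E -> P E = 0%E \/ P E = 1%E.

(* Elementary conditional probability; it is 0 when [P F = 0]. *)
Definition cond_prob (A : alphabetType) (R : realType) (P : source A R)
  (E F : set (infseq A)) : R := fine (P (E `&` F)) / fine (P F).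

(* The letters at times j, ..., k-1 coincide with those of y. *)
Definition window (A : alphabetType) (y : infseq A) (j k : nat) : set (infseq A) :=
  [set x | forall i, (j <= i < k)%N -> x i = y i].

Definition markov_property (A : alphabetType) (R : realType) (m : nat)
  (P : source A R) : Prop :=
  forall (t : nat) (y : infseq A) (a : A), (m <= t)%N ->
    P (window y 0 t) != 0%E ->
    cond_prob P [set x : infseq A | x t = a] (window y 0 t) =
    cond_prob P [set x : infseq A | x t = a] (window y (t - m) t).

Definition markov_source (A : alphabetType) (R : realType) (m : nat)
  (P : source A R) : Prop :=
  [/\ stationary P, ergodic P & markov_property m P].

Definition finite_order_source (A : alphabetType) (R : realType)
  (P : source A R) : Prop := exists m, markov_source m P.

(* [log2 0 = 0] because [ln 0 = 0], so that 0 log 0 = 0; [elog2 0 = -oo]. *)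
Definition log2 (R : realType) (x : R) : R := ln x / ln 2.

Definition elog2 (R : realType) (x : \bar R) : \bar R :=
  (lne x * ((ln 2)^-1)%:E)%E.

Definition entropy (A : alphabetType) (R : realType) (P : source A R)
  (m : nat) : R :=
  - \sum_(v : m.-tuple A) fine (P (cylinder v)) *
      \sum_(a : A)
         let p := cond_prob P [set x : infseq A | x m = a] (cylinder v) in
         p * log2 p.

(* For stationary [P] this limit exists. *)
Definition entropy_rate (A : alphabetType) (R : realType) (P : source A R) : R :=
  limn (entropy P).

(* The component n = 0 is never constrained. *)
Definition word_map (A : alphabetType) := forall n : nat, n.-tuple A -> seq bool.

Definition is_code (A : alphabetType) (phi : word_map A) : Prop :=
  forall n, (0 < n)%N ->
    injective (phi n) /\
    forall us vs : seq (n.-tuple A), us != [::] -> vs != [::] ->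
      flatten (map (phi n) us) = flatten (map (phi n) vs) -> us = vs.

Definition code_length (A : alphabetType) (R : realType) (phi : word_map A)
  (t : nat) (x : infseq A) : R := (size (phi t (sample x t)))%:R.

Definition universal (A : alphabetType) (R : realType) (phi : word_map A) : Prop :=
  forall P : source A R, stationary P -> ergodic P ->
    {ae P, forall x,
       code_length R phi t x / t%:R @[t --> \oo] --> entropy_rate P} /\
    ('E_P[code_length R phi t] * (t%:R^-1)%:E)%E @[t --> \oo]
       --> (entropy_rate P)%:E.

(* In [\bar R]: a sample of pi-probability 0 has left-hand side +oo and is
   rejected. *)
Definition accepts (A : alphabetType) (R : realType) (pi : source A R) (alpha : R)
  (phi : word_map A) (t : nat) (u : t.-tuple A) : bool :=
  (- elog2 (pi (cylinder u)) - (size (phi t u))%:R%:E <= (- log2 alpha)%:E)%E.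

Definition type1_error (A : alphabetType) (R : realType) (pi : source A R)
  (alpha : R) (phi : word_map A) (t : nat) : \bar R :=
  pi [set x | ~~ accepts pi alpha phi (sample x t)].

Definition type2_error (A : alphabetType) (R : realType) (pi : source A R)
  (alpha : R) (phi : word_map A) (tau : source A R) (t : nat) : \bar R :=
  tau [set x | accepts pi alpha phi (sample x t)].

(* Main.v *)
(* Type I: a rejected word u has pi(u) <= alpha 2^-|phi(u)|, and the Kraft sum is
   at most 1.

   Type II, for pi Markov of order m and f = -log pi(x_m | x_0 .. x_(m-1)): the
   ergodic theorem bounds -log pi(x_1 .. x_t) / t below by E_tau f - o(1) in
   tau-probability, while |phi(x_1 .. x_t)| / t tends to h_oo(tau), so it is enough
   that E_tau f > h_oo(tau).  By Gibbs' inequality E_tau f >= h_M(tau) >= h_oo(tau)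
   for M >= m; if E_tau f = h_oo(tau), then tau and pi have the same transition
   probabilities, so tau <= C pi on cylinders, and two ergodic sources one of which
   is dominated by the other coincide.  If tau charges a word of length m+1 that pi
   excludes, the same ergodic theorem shows that this word occurs in the sample
   with tau-probability tending to 1, and then the sample is rejected. *)

Require Import Defs.
From mathcomp Require Import all_boot all_order all_algebra.
From mathcomp Require Import all_classical all_reals all_analysis.
From mathcomp Require Import ring lra.

Set Implicit Arguments.
Unset Strict Implicit.
Unset Printing Implicit Defensive.
Import Order.TTheory GRing.Theory Num.Theory.
Import numFieldNormedType.Exports.
Local Open Scope classical_set_scope.
Local Open Scope ring_scope.

(* [normedtype] defines another [shift]. *)
Local Notation shift := Defs.shift.

(** * Events and random variables determined by a finite prefix *)

(** The padding by [point] is immaterial for whatever is determined by the first [t] letters. *)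
Definition extend (A : alphabetType) (t : nat) (u : t.-tuple A) : infseq A :=
  fun i => nth point u i.

Definition determined (A : alphabetType) (T : Type) (t : nat)
  (f : infseq A -> T) : Prop :=
  forall x y, sample x t = sample y t -> f x = f y.

Definition prob (A : alphabetType) (R : realType) (P : source A R)
  (E : set (infseq A)) : R := fine (P E).

(** When [determined t f], this is the expectation of [f], written as a finite sum over words. *)
Definition mean (A : alphabetType) (R : realType) (P : source A R) (t : nat)
  (f : infseq A -> R) : R :=
  \sum_(u : t.-tuple A) prob P (cylinder u) * f (extend u).

Section Prefixes.
Variables (A : alphabetType) (R : realType).
Implicit Types (x y : infseq A) (P : source A R).

Lemma sample_eqP x y t :
  sample x t = sample y t <-> (forall i, (i < t)%N -> x i = y i).
Proof.
split=> [eq_xy i lt_it|eq_xy].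
  by have := congr1 (fun u : t.-tuple A => tnth u (Ordinal lt_it)) eq_xy;
     rewrite !tnth_mktuple.
by apply: eq_from_tnth => i; rewrite !tnth_mktuple; exact: eq_xy.
Qed.

Lemma nth_sample x t a i : (i < t)%N -> nth a (sample x t) i = x i.
Proof.
by move=> lt_it; rewrite -[i]/(nat_of_ord (Ordinal lt_it)) -tnth_nth tnth_mktuple.
Qed.

Lemma sample_extend t (u : t.-tuple A) : sample (extend u) t = u.
Proof. by apply: eq_from_tnth => i; rewrite tnth_mktuple /extend -tnth_nth. Qed.

Lemma extend_sample x t i : (i < t)%N -> extend (sample x t) i = x i.
Proof. exact: nth_sample. Qed.

Lemma extend_sampleK x t : sample (extend (sample x t)) t = sample x t.
Proof. exact: sample_extend. Qed.

Lemma iter_shiftE n x i : iter n (@shift A) x i = x (n + i)%N.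
Proof. by elim: n i => [//|n IHn] i; rewrite iterS /shift IHn addSnnS. Qed.

Lemma determinedW T t s (f : infseq A -> T) :
  (t <= s)%N -> determined t f -> determined s f.
Proof.
move=> le_ts df x y /sample_eqP eq_xy; apply/df/sample_eqP => i lt_it.
exact/eq_xy/(leq_trans lt_it).
Qed.

Lemma determined_sample t : determined t (fun x => sample x t).
Proof. by []. Qed.

Lemma determined_comp T U t (f : infseq A -> T) (g : T -> U) :
  determined t f -> determined t (g \o f).
Proof. by move=> df x y /df /= ->. Qed.

Lemma determined_iter_shift T t n (f : infseq A -> T) :
  determined t f -> determined (n + t) (fun x => f (iter n (@shift A) x)).
Proof.
move=> df x y /sample_eqP eq_xy; apply/df/sample_eqP => i lt_it.
by rewrite !iter_shiftE; apply: eq_xy; rewrite ltn_add2l.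
Qed.

Lemma determined_shift T t (f : infseq A -> T) :
  determined t f -> determined t.+1 (fun x => f (shift x)).
Proof. exact: (determined_iter_shift (n := 1)). Qed.

Lemma determined_sum t n (f : 'I_n -> infseq A -> R) :
  (forall i, determined t (f i)) -> determined t (fun x => \sum_(i < n) f i x).
Proof. by move=> df x y eq_xy; apply: eq_bigr => i _; exact: df. Qed.

Lemma determined_birkhoff k n (f : infseq A -> R) : determined k f ->
  determined (n + k) (fun x => \sum_(i < n) f (iter i (@shift A) x)).
Proof.
move=> df; apply: determined_sum => i.
apply: determinedW (determined_iter_shift df).
by rewrite leq_add2r ltnW.
Qed.

Lemma determined_cylinder t (u : t.-tuple A) : determined t (cylinder u).
Proof. by move=> x y; rewrite /cylinder /= => ->. Qed.

Lemma measurable_cylinder t (u : t.-tuple A) : measurable (cylinder u).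
Proof.
have -> : cylinder u = \bigcap_(i in `I_t) [set x | x i = extend u i].
  apply/seteqP; split=> x /=.
    by move=> xu i /= lt_it; rewrite -xu extend_sample.
  move=> xu; rewrite /cylinder /= -(sample_extend u); apply/sample_eqP => i.
  exact: xu.
apply: bigcap_measurableType => i _; apply: sub_sigma_algebra.
by exists i, (extend u i).
Qed.

Lemma measurable_shift (E : set (infseq A)) :
  measurable E -> measurable (@shift A @^-1` E).
Proof.
suff : measurable_fun [set: infseq A] (@shift A : infseq A -> infseq A).
  by move=> mT mE; rewrite -[X in measurable X]setTI; exact: mT.
apply: (@measurability _ _ (infseq A) (infseq A) setT (@Defs.shift A)
  (@coordinate_sets A)) => //.
move=> _ [_ [i [a ->]] <-]; rewrite setTI; apply: sub_sigma_algebra.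
by exists i.+1, a.
Qed.

Lemma bigcup_cylinder t (D : set (infseq A)) : determined t D ->
  D = \bigcup_(u in [set u : t.-tuple A | D (extend u)]) cylinder u.
Proof.
move=> dD; apply/seteqP; split=> x.
  by move=> Dx; exists (sample x t) => //=; rewrite (dD _ x) ?extend_sampleK.
by move=> [u /= Du xu]; rewrite (dD _ (extend u)) // sample_extend.
Qed.

Lemma measurable_determined t (D : set (infseq A)) :
  determined t D -> measurable D.
Proof.
move=> /bigcup_cylinder ->; apply: fin_bigcup_measurable => // u _.
exact: measurable_cylinder.
Qed.

Lemma measure_determined P t (D : set (infseq A)) : determined t D ->
  P D = (\sum_(u : t.-tuple A | `[< D (extend u) >]) P (cylinder u))%E.
Proof.
move=> dD; rewrite [in LHS](bigcup_cylinder dD) measure_fin_bigcup //.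
- rewrite fsbig_mkcond (fsbigE (index_enum _)) ?index_enum_uniq //; last first.
    by move=> u _; rewrite mem_index_enum.
  rewrite (eq_bigl predT) => [|u]; last by rewrite in_setT.
  by rewrite [RHS]big_mkcond.
- exact: finite_finset.
- by move=> u v _ _ [x [/= <- <-]].
- by move=> u _; exact: measurable_cylinder.
Qed.

Lemma prob_ge0 P E : 0 <= prob P E.
Proof. by rewrite /prob fine_ge0. Qed.

Lemma probE P E : measurable E -> P E = (prob P E)%:E.
Proof. by move=> mE; rewrite /prob fineK // fin_num_measure. Qed.

Lemma le_prob P E F : measurable E -> measurable F -> E `<=` F ->
  prob P E <= prob P F.
Proof.
by move=> mE mF EF; rewrite -lee_fin -!probE // le_measure ?inE.
Qed.

Lemma prob_le1 P E : measurable E -> prob P E <= 1.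
Proof. by move=> mE; rewrite -lee_fin -probE // probability_le1. Qed.

Lemma prob_determined P t (D : set (infseq A)) : determined t D ->
  prob P D = \sum_(u : t.-tuple A | `[< D (extend u) >]) prob P (cylinder u).
Proof.
move=> dD; apply/eqP; rewrite -eqe -probE; last exact: measurable_determined dD.
apply/eqP; rewrite (measure_determined P dD) -sumEFin; apply: eq_bigr => u _.
by rewrite probE //; exact: measurable_cylinder.
Qed.

Lemma sum_prob_cylinder P t : \sum_(u : t.-tuple A) prob P (cylinder u) = 1.
Proof.
rewrite -[RHS]/(fine 1) -(probability_setT P) -/(prob P setT).
rewrite (@prob_determined P t) //.
by apply: eq_bigl => u; apply/esym/asboolP.
Qed.

(** * Means of functions of finitely many letters *)

(** Change of variables: words are grouped by the value of [g]. With [g] a prefix, or a block read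
    after a shift, it reduces an identity of means to one of laws. *)
Lemma mean_image P t (U : finType) (g : infseq A -> U) (G : U -> R) :
  determined t g ->
  mean P t (fun x => G (g x)) = \sum_v prob P [set x | g x = v] * G v.
Proof.
move=> dg; rewrite /mean (partition_big (fun u => g (extend u)) predT) //=.
apply: eq_bigr => v _.
rewrite (@prob_determined P t); last by move=> x y /dg /= ->.
rewrite big_distrl /=; apply: eq_big => [u|u /eqP -> //].
by apply/eqP/asboolP.
Qed.

Lemma eq_mean P t f g : (forall x, f x = g x) -> mean P t f = mean P t g.
Proof. by move=> eq_fg; apply: eq_bigr => u _; rewrite eq_fg. Qed.

Lemma determinedE T t (f : infseq A -> T) x :
  determined t f -> f x = f (extend (sample x t)).
Proof. by apply; rewrite extend_sampleK. Qed.

Lemma mean_widen P t s f : determined t f -> (t <= s)%N ->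
  mean P s f = mean P t f.
Proof.
move=> df le_ts; rewrite (@eq_mean _ _ _ (fun x => f (extend (sample x t)))).
  rewrite (@mean_image _ _ _ (fun x => sample x t) (fun u => f (extend u))) //.
  exact: (determinedW le_ts).
by move=> x; exact: determinedE.
Qed.

Lemma prob_shift P (E : set (infseq A)) : stationary P -> measurable E ->
  prob P (fun x => E (shift x)) = prob P E.
Proof. by move=> sP mE; rewrite /prob -[in RHS]sP. Qed.

Lemma prob_iter_shift P n (E : set (infseq A)) : stationary P -> measurable E ->
  prob P (fun x => E (iter n (@shift A) x)) = prob P E.
Proof.
move=> sP; elim: n E => [//|n IHn] E mE.
by rewrite (IHn (fun x => E (shift x))) ?prob_shift //; exact: measurable_shift.
Qed.

Lemma mean_iter_shift P n t f : stationary P -> determined t f ->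
  mean P (n + t) (fun x => f (iter n (@shift A) x)) = mean P t f.
Proof.
move=> sP df.
rewrite (@eq_mean _ _ _ (fun x => f (extend (sample (iter n (@shift A) x) t)))).
  rewrite (@mean_image _ _ _ (fun x => sample (iter n (@shift A) x) t)
            (fun u => f (extend u))); last first.
    exact: (@determined_iter_shift _ t n (fun x => sample x t)).
  apply: eq_bigr => u _; congr (_ * _).
  by rewrite -(@prob_iter_shift _ n (cylinder u)) //; exact: measurable_cylinder.
by move=> x; exact: determinedE.
Qed.

Lemma meanD P t f g : mean P t (fun x => f x + g x) = mean P t f + mean P t g.
Proof. by rewrite /mean -big_split; apply: eq_bigr => u _; rewrite mulrDr. Qed.

Lemma meanN P t f : mean P t (fun x => - f x) = - mean P t f.
Proof. by rewrite /mean -sumrN; apply: eq_bigr => u _; rewrite mulrN. Qed.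

Lemma mean_cst P t (c : R) : mean P t (fun=> c) = c.
Proof. by rewrite /mean -big_distrl /= sum_prob_cylinder mul1r. Qed.

Lemma meanZ P t (c : R) f : mean P t (fun x => c * f x) = c * mean P t f.
Proof. by rewrite /mean big_distrr; apply: eq_bigr => u _; rewrite /= mulrCA. Qed.

Lemma le_mean P t f g : (forall x, f x <= g x) -> mean P t f <= mean P t g.
Proof.
by move=> le_fg; apply: ler_sum => u _; rewrite ler_wpM2l ?prob_ge0.
Qed.

Lemma mean_indicator P t (D : set (infseq A)) : determined t D ->
  mean P t (fun x => (`[< D x >] : bool)%:R) = prob P D.
Proof.
move=> dD; rewrite (prob_determined P dD) [RHS]big_mkcond; apply: eq_bigr => u _.
by case: ifP => _; rewrite ?mulr1 ?mulr0.
Qed.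

End Prefixes.

(** * A one-sided ergodic theorem in probability *)

(* Satisfies [peak h n x = max(0, S_1, ..., S_n)] for the Birkhoff sums
   [S_j = \sum_(i < j) h (iter i shift x)]. *)
Fixpoint peak (A : alphabetType) (R : realType) (h : infseq A -> R) (n : nat)
    (x : infseq A) : R :=
  if n is n'.+1 then Num.max 0 (h x + peak h n' (shift x)) else 0.

Section Ergodic.
Variables (A : alphabetType) (R : realType).
Implicit Types (x y : infseq A) (P : source A R) (f h : infseq A -> R).

(** [P (F n)] is at most the probability of the union of the [F k], [k >= n], which decreases to
    that of the limsup. This turns almost sure statements into convergence in probability. *)
Lemma cvg_prob0_lim_sup P (F : (set (infseq A))^nat) :
  (forall n, measurable (F n)) -> P.-negligible (lim_sup_set F) ->
  P (F n) @[n --> \oo] --> 0%E.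
Proof.
move=> mF nF.
have mU n : measurable (\bigcup_(k >= n) F k) by exact: bigcup_measurable.
have P0 : P (lim_sup_set F) = 0%E.
  by apply/measure_negligible => //; apply: bigcap_measurable.
apply: (@squeeze_cvge _ _ _ _ (fun=> 0%E) _ (fun n => P (\bigcup_(k >= n) F k))).
- apply: nearW => n; rewrite measure_ge0 /= le_measure ?inE //.
  by move=> x Fx; exists n => //=.
- exact: cvg_cst.
- rewrite -P0; apply: lim_sup_set_cvg => //.
  by rewrite (le_lt_trans (probability_le1 P _)) ?ltry //.
Qed.

Lemma determined_bounded k f : determined k f ->
  exists b : nat, forall x, `|f x| <= b%:R.
Proof.
move=> df; exists (Num.truncn (\sum_(u : k.-tuple A) `|f (extend u)|)).+1 => x.
rewrite (determinedE x df) (le_trans _ (ltW (truncnS_gt _))) //.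
by rewrite (bigD1 (sample x k)) //= lerDl sumr_ge0.
Qed.

Lemma determined_peak k h n : determined k h -> determined (n + k) (peak h n).
Proof.
move=> dh; elim: n => [//|n IHn] x y eq_xy /=.
rewrite (determinedW (leq_addl n.+1 k) dh eq_xy).
by rewrite (determined_shift IHn eq_xy).
Qed.

Lemma peak_ge0 h n x : 0 <= peak h n x.
Proof. by case: n => //= n; rewrite le_max lexx. Qed.

Lemma peak_leS h n x : peak h n x <= peak h n.+1 x.
Proof.
elim: n x => [|n IHn] x; first exact: peak_ge0.
rewrite /= ge_max le_max lexx /= le_max; apply/orP; right.
by rewrite lerD2l; exact: IHn.
Qed.

Lemma peak_le h x m n : (m <= n)%N -> peak h m x <= peak h n x.
Proof. exact: (homo_leq (@lexx _ R) (@le_trans _ R) (peak_leS h ^~ x)). Qed.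

Lemma sum_le_peak h n x : \sum_(i < n) h (iter i (@shift A) x) <= peak h n x.
Proof.
elim: n x => [|n IHn] x; first by rewrite big_ord0.
rewrite big_ord_recl /= le_max; apply/orP; right; rewrite lerD2l.
apply: le_trans (IHn _); rewrite le_eqVlt; apply/orP; left.
by apply/eqP/eq_bigr => i _; rewrite -iterS iterSr.
Qed.

(* Garsia's argument: where the peak is positive, [h] dominates the coboundary
   [peak h n - peak h n \o shift], whose mean vanishes. *)
Lemma maximal_ergodic P k h (b : R) n : stationary P -> determined k h ->
  (forall x, - b <= h x) ->
  - (b * prob P [set x | peak h n x <= 0]) <= mean P k h.
Proof.
move=> sP dh hb; have dp := determined_peak (n := n) dh.
have dD : determined (n + k) [set x | peak h n x <= 0].
  by move=> x y /dp /= ->.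
(* All means are taken over words of length [(n + k).+1], long enough to determine [peak h n] after
   one shift. *)
rewrite -(mean_widen P dh (leqW (leq_addl n k))).
rewrite -(mean_indicator P (determinedW (leqnSn _) dD)) -meanZ.
have coboundary : mean P (n + k).+1
    (fun x => peak h n x - peak h n (shift x)) = 0.
  by rewrite meanD meanN (mean_widen P dp) // (mean_iter_shift 1 sP dp) subrr.
rewrite -[leLHS]add0r -[X in X - _]coboundary -meanN -meanD.
apply: le_mean => x /=; case: asboolP => /= [p0|/negP]; last first.
  rewrite -ltNge => p_gt0; rewrite mulr0 subr0.
  have : peak h n x <= h x + peak h n (shift x).
    case: n p_gt0 {coboundary dp dD} => [|n] /=; first by rewrite ltxx.
    rewrite lt_max ltxx /= => h_gt0; rewrite ge_max (ltW (lt_le_trans h_gt0 _)) /=;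
    by rewrite lerD2l; apply: (peak_leS h).
  lra.
by have := peak_ge0 h n (shift x); have := hb x; move: p0; rewrite /=; lra.
Qed.

Lemma measurable_peak_unbounded k h : determined k h ->
  measurable [set x | forall K : nat, exists n, K%:R < peak h n x].
Proof.
move=> dh; set E := (X in measurable X).
have -> : E = \bigcap_K \bigcup_n [set x | K%:R < peak h n x].
  apply/seteqP; split=> x Ex K; first by move=> _; have [n] := Ex K; exists n.
  by have [n _] := Ex K I; exists n.
apply: bigcap_measurableType => K _; apply: bigcupT_measurable => n.
apply: (@measurable_determined _ (n + k)).
by move=> x y /(determined_peak dh) /= ->.
Qed.

(** The event is invariant, so it has probability 0 or 1. Were it 1, the event [peak h n <= 0] would
    have probability tending to 0, and the maximal inequality would give [mean P k h >= 0]. *)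
Lemma peak_bounded P k h : stationary P -> ergodic P -> determined k h ->
  mean P k h < 0 ->
  P [set x | forall K : nat, exists n, K%:R < peak h n x] = 0%E.
Proof.
move=> sP eP dh mh; set E := (X in P X).
have [b hb] := determined_bounded dh.
have mE : measurable E by exact: measurable_peak_unbounded dh.
(* One shift changes a positive peak by at most the bound [b] of [h]; asking for the threshold
   [K + b] absorbs this. *)
have iE : @shift A @^-1` E = E.
  apply/seteqP; split=> x Ex K.
    have [n] := Ex (K + b)%N; rewrite natrD => lt_Kp; exists n.+1 => /=.
    have := hb x; rewrite ler_norml => /andP[hx _].
    by rewrite lt_max; apply/orP; right; lra.
  have [[|n]] := Ex (K + b)%N; rewrite natrD /=.
    by rewrite -natrD ltrn0.
  move=> lt_Kp; exists n.
  have := hb x; rewrite ler_norml => /andP[_ hx].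
  have := ler0n R K; have := ler0n R b.
  by move: lt_Kp; rewrite lt_max => /orP[|]; lra.
have [//|P1] := eP _ mE iE; exfalso.
pose G n := [set x | peak h n x <= 0].
have mG n : measurable (G n).
  apply: (@measurable_determined _ (n + k)) => x y eq_xy.
  by rewrite /G /= (determined_peak dh eq_xy).
have : P (G n) @[n --> \oo] --> 0%E.
  apply: cvg_prob0_lim_sup => //; exists (~` E); split.
  - exact: measurableC.
  - by rewrite probability_setC // P1 subee.
  - move=> x Gx Ex; have [n p_gt0] := Ex 0%N.
    have [m /= le_nm] := Gx n I.
    by rewrite /G /= leNgt (lt_le_trans p_gt0) // peak_le.
(* The divisor is [b.+1] because [b] may be 0. *)
move=> /fine_cvgP[_ /cvgrPdist_lt] /(_ (- mean P k h / b.+1%:R)).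
rewrite divr_gt0 ?oppr_gt0 // => /(_ isT) [n _ /(_ n (leqnn n))] /=.
rewrite sub0r normrN ger0_norm ?prob_ge0 // ltr_pdivlMr //.
have hb' x : - b%:R <= h x by have := hb x; rewrite ler_norml => /andP[].
have := maximal_ergodic n sP dh hb'.
have := prob_ge0 P (G n); rewrite -/(prob P (G n)) -/(G n) -natr1.
by nra.
Qed.

(** With [c'] halfway between [c] and the mean, [h = c' - f] has negative mean, so its peaks are
    almost surely bounded. If the [f]-sum is at most [c * n] for infinitely many [n], the [h]-sums
    are at least [(c' - c) * n] there, hence unbounded. *)
Lemma birkhoff_lower_tail P k f (c : R) : stationary P -> ergodic P ->
  determined k f -> c < mean P k f ->
  P [set x | \sum_(i < n) f (iter i (@shift A) x) <= c * n%:R]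
    @[n --> \oo] --> 0%E.
Proof.
move=> sP eP df lt_c; set c' := (c + mean P k f) / 2.
pose h x := c' - f x.
have dh : determined k h by move=> x y /df; rewrite /h => ->.
have mh : mean P k h < 0.
  by rewrite /h meanD mean_cst meanN /c'; lra.
apply: cvg_prob0_lim_sup => [n|].
  apply: (@measurable_determined _ (n + k)) => x y eq_xy /=.
  by rewrite (determined_birkhoff df eq_xy).
have P0 := peak_bounded sP eP dh mh.
have : P.-negligible [set x | forall K : nat, exists n, K%:R < peak h n x].
  apply/negligibleP => //.
  exact: measurable_peak_unbounded dh.
apply: negligibleS => x Fx K.
have lt_cc' : 0 < c' - c by rewrite /c'; lra.
pose N := (Num.truncn (K%:R / (c' - c))).+1.
have [n /= le_Nn Fn] := Fx N I; exists n.
apply: lt_le_trans (sum_le_peak h n x).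
rewrite /h big_split /= sumrN sumr_const card_ord -mulr_natr.
have : K%:R < (c' - c) * n%:R.
  rewrite mulrC -ltr_pdivrMr // (lt_le_trans (truncnS_gt _)) //.
  by rewrite ler_nat.
lra.
Qed.

End Ergodic.

(** * The Kraft-McMillan inequality and the Type I error *)

Section Kraft.
Variables (A : alphabetType) (R : realType).

(** If [S = 1 + d] with [d > 0], Bernoulli's inequality, squared, makes [S ^+ (k * 2)] grow at least
    quadratically in [k], faster than the linear bound. *)
Lemma le1_exprn_linear (S : R) (L : nat) :
  (forall r, (0 < r)%N -> S ^+ r <= (r * L).+1%:R) -> S <= 1.
Proof.
move=> leS; rewrite leNgt; apply/negP => S_gt1.
pose d := S - 1; have d_gt0 : 0 < d by rewrite subr_gt0.
have bernoulli k : 1 + k%:R * d <= S ^+ k.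
  elim: k => [|k IHk]; first by rewrite mul0r addr0 expr0.
  have : S * (1 + k%:R * d) <= S ^+ k.+1.
    by rewrite exprS ler_pM2l // (lt_trans ltr01).
  apply: le_trans; rewrite -natr1.
  have -> : S * (1 + k%:R * d) = 1 + (k%:R + 1) * d + k%:R * (d * d).
    by rewrite /d; ring.
  by rewrite lerDl mulr_ge0 ?mulr_ge0 // ltW.
(* Then [k d^2 > 2L + 1], so [(1 + k d)^2] exceeds [2 k L + 1], the bound at [r = 2k]. *)
pose k := (Num.truncn (L.*2.+1%:R / (d * d))).+1.
have k_gt : L.*2.+1%:R < k%:R * (d * d).
  by rewrite -ltr_pdivrMr ?mulr_gt0 // truncnS_gt.
have := leS (k * 2)%N isT; rewrite exprM -[(_ * 2 * L)%N]mulnA mul2n.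
rewrite -natr1 natrM; move: k_gt; rewrite -natr1.
have := bernoulli k; have : 1 <= k%:R :> R by rewrite ler1n.
set K := k%:R; set M := L.*2%:R => K1 le_S lt_K.
have : (1 + K * d) ^+ 2 <= (S ^+ k) ^+ 2.
  by rewrite ler_sqr ?nnegrE //; nra.
have : K * (M + 1) < K * (K * (d * d)) by rewrite ltr_pM2l //; lra.
have : 0 < K * d by rewrite mulr_gt0 //; lra.
rewrite [(1 + _) ^+ 2]expr2 => h1 h2 h3 h4; nra.
Qed.

(** There are at most [2 ^ l] distinct binary words of length [l], each of weight [2 ^ -l]. *)
Lemma sum_words_le1 (I : finType) (D : {pred I}) (w : I -> seq bool) (l : nat) :
  {in D &, injective w} -> (forall i, i \in D -> size (w i) = l) ->
  \sum_(i in D) 2^-1 ^+ size (w i) <= 1 :> R.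
Proof.
move=> injw szw; rewrite (eq_bigr (fun=> 2^-1 ^+ l)) => [|i /szw -> //].
rewrite sumr_const -[leLHS]mulr_natr exprVn [leLHS]mulrC ler_pdivrMr ?exprn_gt0 // mul1r.
rewrite -natrX ler_nat -card_bool -card_tuple.
pose g i := [tuple nth false (w i) j | j < l].
apply: (@leq_card_in _ _ g) => i j Di Dj /(congr1 val) eq_g; apply: injw => //.
have gE k : k \in D -> w k = g k.
  move=> Dk; apply: (@eq_from_nth _ false); first by rewrite szw // size_tuple.
  move=> m; rewrite szw // => lt_ml; rewrite -[m]/(nat_of_ord (Ordinal lt_ml)).
  by rewrite -tnth_nth tnth_mktuple.
by rewrite (gE i) // (gE j).
Qed.

(* McMillan's trick: the r-th power of the Kraft sum counts the concatenations
   of r codewords, which are distinct words of length at most r L. *)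
Lemma kraft_mcmillan (phi : word_map A) n : is_code phi -> (0 < n)%N ->
  \sum_(u : n.-tuple A) 2^-1 ^+ size (phi n u) <= 1 :> R.
Proof.
move=> code n_gt0; have [_ decode] := code n n_gt0.
pose L := (\max_(u : n.-tuple A) size (phi n u))%N.
apply: (@le1_exprn_linear _ L) => r r_gt0.
pose w (f : {ffun 'I_r -> n.-tuple A}) :=
  flatten [seq phi n u | u <- [seq f i | i <- enum 'I_r]].
have szw f : size (w f) = (\sum_(i < r) size (phi n (f i)))%N.
  by rewrite size_flatten sumnE /shape 3!big_map big_enum.
have injw : injective w.
  have neq0 (f : {ffun 'I_r -> n.-tuple A}) : [seq f i | i <- enum 'I_r] != [::].
    by rewrite -size_eq0 size_map -cardE card_ord -lt0n.
  move=> f g /(decode _ _ (neq0 f) (neq0 g)) eq_fg; apply/ffunP => i.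
  by move/eq_in_map: eq_fg; apply; rewrite mem_enum.
(* Expanding the power gives one term per choice [f] of [r] source words. *)
have -> : (\sum_(u : n.-tuple A) 2^-1 ^+ size (phi n u)) ^+ r =
    \sum_(f : {ffun 'I_r -> n.-tuple A}) 2^-1 ^+ size (w f) :> R.
  rewrite -[in LHS](card_ord r) -prodr_const bigA_distr_bigA.
  by apply: eq_bigr => f _; rewrite szw -prodrXr.
have le_w f : (size (w f) < (r * L).+1)%N.
  rewrite ltnS szw -[in (r * L)%N](card_ord r) -sum_nat_const.
  by apply: leq_sum => i _; exact: leq_bigmax.
(* Grouping by total length leaves [r * L + 1] classes, each contributing at most 1. *)
rewrite (partition_big (fun f => Ordinal (le_w f)) predT) //=.
rewrite -[in leRHS](card_ord (r * L).+1) -sumr_const; apply: ler_sum => l _.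
apply: (@sum_words_le1 _ [pred f | Ordinal (le_w f) == l] w l) => [f g _ _|f].
  exact: injw.
by rewrite inE => /eqP <-.
Qed.

(** * The Type I error *)

Lemma ln2_gt0 : 0 < ln 2 :> R.
Proof. by rewrite ln_gt0 // ltr1n. Qed.

Lemma rejected_prob (pi : source A R) (alpha : R) (phi : word_map A) t
    (u : t.-tuple A) : 0 < alpha -> ~~ accepts pi alpha phi u ->
  prob pi (cylinder u) <= alpha * 2^-1 ^+ size (phi t u).
Proof.
move=> alpha_gt0; rewrite /accepts -ltNge (probE pi); last exact: measurable_cylinder.
(* A word of probability 0 satisfies the bound trivially; for the others logarithms can be
   compared. *)
have [->|p_neq0] := eqVneq (prob pi (cylinder u)) 0.
  by move=> _; rewrite mulr_ge0 ?exprn_ge0 ?invr_ge0 // ltW.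
have p_gt0 : 0 < prob pi (cylinder u) by rewrite lt_def p_neq0 prob_ge0.
rewrite /elog2 lne_EFin // -EFinM -EFinN -EFinB lte_fin => lt_log.
have ln20 := ln2_gt0.
rewrite -ler_ln ?posrE ?mulr_gt0 ?exprn_gt0 ?invr_gt0 //.
rewrite lnM ?posrE ?exprn_gt0 ?invr_gt0 // lnXn ?invr_gt0 // lnV ?posrE //.
move: lt_log; rewrite /log2 -(ltr_pM2r ln20) mulrBl !mulNr !divfK ?gt_eqF //.
by rewrite -mulr_natl; lra.
Qed.

Lemma type1_error_le (pi : source A R) (alpha : R) (phi : word_map A) t :
  0 < alpha -> is_code phi -> (0 < t)%N ->
  (type1_error pi alpha phi t <= alpha%:E)%E.
Proof.
move=> alpha_gt0 code t_gt0; rewrite /type1_error.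
set D := (X in pi X).
have dD : determined t D by move=> x y /= eq_xy; rewrite /D /= eq_xy.
rewrite (probE pi); last exact: measurable_determined dD.
rewrite lee_fin (prob_determined pi dD).
apply: le_trans (_ : \sum_(u : t.-tuple A) alpha * 2^-1 ^+ size (phi t u) <= _).
  rewrite big_mkcond; apply: ler_sum => u _; case: asboolP => [|_].
    by rewrite /D /= sample_extend; exact: rejected_prob.
  by rewrite mulr_ge0 ?exprn_ge0 ?invr_ge0 // ltW.
by rewrite -big_distrr /= ler_piMr ?kraft_mcmillan // ltW.
Qed.

End Kraft.

(** * Entropy as a mean and Gibbs' inequality *)

(** A function of sequences rather than of words, so that it composes with the shift. *)
Definition prefix_prob (A : alphabetType) (R : realType) (P : source A R)
  (t : nat) (x : infseq A) : R := prob P (cylinder (sample x t)).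

(** The conditional probability of [x m] given the [m] letters before it; it is 0 on a prefix of
    probability 0. *)
Definition transition (A : alphabetType) (R : realType) (P : source A R)
  (m : nat) (x : infseq A) : R := prefix_prob P m.+1 x / prefix_prob P m x.

Definition set_letter (A : alphabetType) (x : infseq A) (t : nat) (a : A) :
  infseq A := fun i => if i == t then a else x i.

Section Entropy.
Variables (A : alphabetType) (R : realType).
Implicit Types (x y : infseq A) (P : source A R) (f h q : infseq A -> R).

Lemma set_letter_sample x t a : sample (set_letter x t a) t = sample x t.
Proof. by apply/sample_eqP => i lt_it; rewrite /set_letter ltn_eqF. Qed.

Lemma iter_shift_set_letter x n m a :
  iter n (@shift A) (set_letter x (n + m) a) =
  set_letter (iter n (@shift A) x) m a.
Proof.
by apply/funext => i; rewrite /set_letter !iter_shiftE eqn_add2l.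
Qed.

Lemma sum_extendS t f : determined t.+1 f ->
  \sum_(u : t.+1.-tuple A) f (extend u) =
  \sum_(v : t.-tuple A) \sum_(a : A) f (set_letter (extend v) t a).
Proof.
move=> df; rewrite pair_big /=.
rewrite (reindex (fun p : t.-tuple A * A => sample (set_letter (extend p.1) t p.2) t.+1)) /=.
  by apply: eq_bigr => p _; apply: df; rewrite extend_sampleK.
exists (fun u => (sample (extend u) t, extend u t)) => [[v a] _|u _] /=.
  rewrite extend_sample // /set_letter eqxx; congr (_, _).
  rewrite -[RHS]sample_extend; apply/sample_eqP => i lt_it.
  by rewrite extend_sample ?ltn_eqF // ltnS ltnW.
rewrite -[RHS]sample_extend; apply/sample_eqP => i; rewrite ltnS /set_letter.
by case: eqP => [->//|/eqP neq_it le_it]; rewrite extend_sample // ltn_neqAle neq_it.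
Qed.

Lemma determined_prefix_prob P t : determined t (prefix_prob P t).
Proof. by move=> x y; rewrite /prefix_prob => ->. Qed.

Lemma determined_transition P t : determined t.+1 (transition P t).
Proof.
move=> x y eq_xy; rewrite /transition (determined_prefix_prob _ eq_xy).
by rewrite (determinedW (leqnSn t) (@determined_prefix_prob P t) eq_xy).
Qed.

Lemma prefix_prob_ge0 P t x : 0 <= prefix_prob P t x.
Proof. exact: prob_ge0. Qed.

Lemma prefix_prob_gt0 P t x : (0 < prefix_prob P t x) = (prefix_prob P t x != 0).
Proof. by rewrite lt_def prefix_prob_ge0 andbT. Qed.

Lemma prefix_prob_le1 P t x : prefix_prob P t x <= 1.
Proof. by apply: prob_le1; exact: measurable_cylinder. Qed.

Lemma prefix_prob_le P s t x : (s <= t)%N -> prefix_prob P t x <= prefix_prob P s x.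
Proof.
move=> le_st; apply: le_prob; try exact: measurable_cylinder.
by move=> y; exact: (determinedW le_st (@determined_sample A s)).
Qed.

Lemma transition_ge0 P t x : 0 <= transition P t x.
Proof. by rewrite divr_ge0 ?prefix_prob_ge0. Qed.

Lemma transition_gt0 P t x : 0 < prefix_prob P t.+1 x -> 0 < transition P t x.
Proof.
by move=> p_gt0; rewrite divr_gt0 // (lt_le_trans p_gt0) // prefix_prob_le.
Qed.

Lemma transition_le1 P t x : transition P t x <= 1.
Proof.
rewrite /transition.
have [->|p_neq0] := eqVneq (prefix_prob P t x) 0; first by rewrite invr0 mulr0.
by rewrite ler_pdivrMr ?prefix_prob_gt0 // mul1r prefix_prob_le.
Qed.

(** The product formula survives on null prefixes, where both sides vanish by monotonicity. *)
Lemma prefix_probS P t x :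
  prefix_prob P t.+1 x = prefix_prob P t x * transition P t x.
Proof.
rewrite /transition mulrC.
have [p0|p_neq0] := eqVneq (prefix_prob P t x) 0; last by rewrite divfK.
rewrite p0 mulr0; apply/eqP; rewrite eq_le prefix_prob_ge0 andbT -p0.
exact: prefix_prob_le.
Qed.

Lemma sum_prefix_prob P t x :
  \sum_(a : A) prefix_prob P t.+1 (set_letter x t a) = prefix_prob P t x.
Proof.
(* The indicator keeps the words extending the prefix of [x]; after splitting off the last letter
   only one [v] remains. *)
pose f y := prefix_prob P t.+1 y * (sample y t == sample x t)%:R.
rewrite /prefix_prob (prob_determined P (determinedW (leqnSn t) (@determined_cylinder A _ _))).
have -> : \sum_(u : t.+1.-tuple A | `[< cylinder (sample x t) (extend u) >])
    prob P (cylinder u) = \sum_(u : t.+1.-tuple A) f (extend u).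
  rewrite big_mkcond; apply: eq_bigr => u _; rewrite /f /prefix_prob sample_extend.
  by case: eqP => xu; [rewrite asboolT // mulr1 | rewrite asboolF // mulr0].
rewrite sum_extendS => [|y z eq_yz]; last first.
  by rewrite /f (determined_prefix_prob _ eq_yz)
    (determinedW (leqnSn t) (@determined_sample A t) eq_yz).
rewrite (bigD1 (sample x t)) //= [X in _ + X]big1 => [|v neq_vx].
  rewrite addr0; apply: eq_bigr => a _.
  rewrite /f set_letter_sample sample_extend eqxx mulr1.
  apply: determined_prefix_prob; apply/sample_eqP => i; rewrite ltnS /set_letter.
  by case: eqP => // /eqP neq_it le_it; rewrite extend_sample // ltn_neqAle neq_it.
apply: big1 => a _; rewrite /f set_letter_sample sample_extend (negbTE neq_vx).
by rewrite mulr0.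
Qed.

(** Only an inequality, because the sum is 0 on a null prefix. *)
Lemma sum_transition P t x :
  \sum_(a : A) transition P t (set_letter x t a) <= 1.
Proof.
rewrite (eq_bigr (fun a => prefix_prob P t.+1 (set_letter x t a) / prefix_prob P t x)).
  rewrite -big_distrl /= sum_prefix_prob.
  have [->|p_neq0] := eqVneq (prefix_prob P t x) 0; first by rewrite mul0r.
  by rewrite divff.
by move=> a _; rewrite /transition /prefix_prob set_letter_sample.
Qed.

(** Since [P(v) P(a|v) = P(va)], the double sum is a single mean over words of length [m + 1]. *)
Lemma entropyE P m :
  entropy P m = - mean P m.+1 (fun x => log2 (transition P m x)).
Proof.
congr (- _); pose f x := prefix_prob P m.+1 x * log2 (transition P m x).
have -> : mean P m.+1 (fun x => log2 (transition P m x)) =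
    \sum_(u : m.+1.-tuple A) f (extend u).
  by apply: eq_bigr => u _; rewrite /f /prefix_prob sample_extend.
rewrite sum_extendS => [|x y eq_xy]; last first.
  by rewrite /f (determined_prefix_prob _ eq_xy) (determined_transition _ eq_xy).
apply: eq_bigr => v _; rewrite big_distrr; apply: eq_bigr => a _ /=.
set y := set_letter _ _ _.
have eq_yv : sample y m = v by rewrite set_letter_sample sample_extend.
have -> : cond_prob P [set x : infseq A | x m = a] (cylinder v) = transition P m y.
  rewrite /cond_prob /transition /prefix_prob eq_yv; congr (fine (P _) / _).
  apply/seteqP; split=> x.
    move=> [/= xm xv]; apply/sample_eqP => i; rewrite ltnS leq_eqVlt => /orP[/eqP ->|].
      by rewrite xm /y /set_letter eqxx.
    by move: i; apply/sample_eqP; rewrite eq_yv.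
  move=> /= /sample_eqP xy; split.
    by rewrite /= xy // /y /set_letter eqxx.
  by rewrite /cylinder /= -eq_yv; apply/sample_eqP => i lt_im; apply/xy/ltnW.
rewrite mulrA /f prefix_probS; congr (_ * _ * _).
by rewrite /prefix_prob eq_yv.
Qed.

(** * Gibbs' inequality with its equality case *)

Lemma ln_lt_subr1 (z : R) : 0 < z -> z != 1 -> ln z < z - 1.
Proof.
move=> z_gt0 z_neq1; have lnz0 : ln z != 0 by rewrite ln_eq0.
by have := expR_gt1Dx lnz0; rewrite lnK ?posrE //; lra.
Qed.

(** This is [ln z <= z - 1] at [z = q / p], multiplied by [p]. The [?= iff] form lets the equality
    case pass through a sum. *)
Lemma gibbs_term (p q : R) : 0 <= p -> 0 <= q -> (p != 0 -> q != 0) ->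
  p - q <= p * (ln p - ln q) ?= iff ((p != 0) ==> (p == q)) && ((p == 0) ==> (q == 0)).
Proof.
move=> p_ge0 q_ge0 pq.
have [->|p_neq0] := eqVneq p 0; rewrite /=.
  rewrite mul0r sub0r; split; first by rewrite oppr_le0.
  by rewrite oppr_eq0.
have p_gt0 : 0 < p by rewrite lt_def p_neq0.
have q_gt0 : 0 < q by rewrite lt_def pq.
rewrite andbT.
have [->|neq_pq] := eqVneq p q.
  by rewrite !subrr mulr0; split; rewrite ?eqxx.
have : ln (q / p) < q / p - 1.
  apply: ln_lt_subr1; first exact: divr_gt0.
  by rewrite -subr_eq0 -[1](divff p_neq0) -mulrBl mulf_neq0 ?invr_neq0 // subr_eq0 eq_sym.
rewrite ln_div ?posrE // => lt_ln.
have lt_pq : p - q < p * (ln p - ln q).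
  have : p * (ln q - ln p) < p * (q / p - 1) by rewrite ltr_pM2l.
  rewrite !mulrBr [p * (q / p)]mulrCA divff // !mulr1; lra.
by split; [exact: ltW | exact: lt_eqF].
Qed.

(** Nonnegativity of the relative entropy, in nats. If it is at most 0, every term bound is an
    equality. *)
Lemma gibbs (U : finType) (p q : U -> R) :
  (forall u, 0 <= p u) -> (forall u, 0 <= q u) ->
  (forall u, p u != 0 -> q u != 0) -> \sum_u q u <= \sum_u p u ->
  0 <= \sum_u p u * (ln (p u) - ln (q u)) /\
  (\sum_u p u * (ln (p u) - ln (q u)) <= 0 -> forall u, p u != 0 -> p u = q u).
Proof.
move=> p0 q0 pq le_qp.
have term u := gibbs_term (p0 u) (q0 u) (pq u).
have le_sum : \sum_u p u - \sum_u q u <= \sum_u p u * (ln (p u) - ln (q u)).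
  by rewrite -sumrB; apply: ler_sum => u _; exact: term.
split=> [|le0 u pu]; first by apply: le_trans le_sum; rewrite subr_ge0.
have [_ eq_sum] := leif_sum (fun u (_ : xpredT u) => term u).
have : \sum_u (p u - q u) == \sum_u p u * (ln (p u) - ln (q u)).
  rewrite eq_le sumrB le_sum /= (le_trans le0) // subr_ge0 //.
by rewrite eq_sum => /forallP /(_ u); rewrite /= pu /= => /andP[/eqP].
Qed.

(* [q x] is read as a conditional probability of [x t] given [x 0 .. x t.-1]. *)
Lemma entropy_le_cross P t q :
  determined t.+1 q -> (forall x, 0 <= q x) ->
  (forall x, \sum_(a : A) q (set_letter x t a) <= 1) ->
  (forall x, prefix_prob P t.+1 x != 0 -> q x != 0) ->
  entropy P t <= mean P t.+1 (fun x => - log2 (q x)) /\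
  (mean P t.+1 (fun x => - log2 (q x)) <= entropy P t ->
   forall x, prefix_prob P t.+1 x != 0 -> transition P t x = q x).
Proof.
move=> dq q0 sumq posq.
(* Gibbs' inequality compares the law of [t.+1] letters with the weight obtained by drawing the last
   letter from [q]. *)
pose f x := prefix_prob P t x * q x.
have df : determined t.+1 f.
  move=> x y eq_xy; rewrite /f (dq _ _ eq_xy).
  by rewrite (determinedW (leqnSn t) (@determined_prefix_prob P t) eq_xy).
pose p (u : t.+1.-tuple A) := prefix_prob P t.+1 (extend u).
have p_neq0 x : prefix_prob P t.+1 x != 0 -> prefix_prob P t x != 0.
  rewrite -!prefix_prob_gt0 => /lt_le_trans; apply; exact: prefix_prob_le.
have [||||ge0 eq0] := @gibbs _ p (fun u => f (extend u)).
- by move=> u; exact: prefix_prob_ge0.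
- by move=> u; rewrite mulr_ge0 ?prefix_prob_ge0.
- by move=> u pu; rewrite mulf_neq0 ?p_neq0 ?posq.
- rewrite sum_extendS //.
  have -> : \sum_u p u = 1.
    rewrite -[RHS](sum_prob_cylinder P t.+1); apply: eq_bigr => u _.
    by rewrite /p /prefix_prob sample_extend.
  rewrite -(sum_prob_cylinder P t); apply: ler_sum => v _.
  rewrite (eq_bigr (fun a => prob P (cylinder v) * q (set_letter (extend v) t a))).
    by rewrite -big_distrr ler_piMr ?prob_ge0 //=.
  by move=> a _; rewrite /f /prefix_prob set_letter_sample sample_extend.
have ln2 : 0 < ln 2 :> R by rewrite ln_gt0 // ltr1n.
(* The relative entropy is the gap between cross entropy and entropy; [ln 2] converts bits to
   nats. *)
have sumE : \sum_u p u * (ln (p u) - ln (f (extend u))) =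
    ln 2 * (mean P t.+1 (fun x => - log2 (q x)) - entropy P t).
  rewrite entropyE opprK -meanD -meanZ; apply: eq_bigr => u _.
  rewrite /p [prefix_prob _ _ _ in LHS]/prefix_prob sample_extend.
  have pE : prefix_prob P t.+1 (extend u) = prob P (cylinder u).
    by rewrite /prefix_prob sample_extend.
  have [->|pu] := eqVneq (prob P (cylinder u)) 0; first by rewrite !mul0r.
  have pu' : prefix_prob P t.+1 (extend u) != 0 by rewrite pE.
  congr (_ * _); rewrite /log2 mulrDr mulrN ![ln 2 * _]mulrC !divfK ?gt_eqF //.
  rewrite /f lnM ?posrE ?prefix_prob_gt0 ?p_neq0 //; last by rewrite lt_def q0 posq.
  rewrite -pE prefix_probS lnM ?posrE ?prefix_prob_gt0 ?p_neq0 //; first by ring.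
  by rewrite transition_gt0 // prefix_prob_gt0.
move: ge0 eq0; rewrite sumE pmulr_rge0 // subr_ge0 => ge0 eq0; split=> // le_mean x px.
have pxE : p (sample x t.+1) = prefix_prob P t.+1 x.
  by apply: determined_prefix_prob; rewrite extend_sampleK.
have /eq0 : ln 2 * (mean P t.+1 (fun x => - log2 (q x)) - entropy P t) <= 0.
  by rewrite pmulr_rle0 // subr_le0.
move=> /(_ (sample x t.+1)); rewrite pxE => /(_ px).
rewrite -(determinedE x df) /f prefix_probS; apply: mulfI; exact: p_neq0.
Qed.

Lemma entropy_ge0 P t : 0 <= entropy P t.
Proof.
rewrite entropyE oppr_ge0 -[leRHS](mean_cst P t.+1); apply: le_mean => x.
rewrite /log2 pmulr_lle0 ?invr_gt0 ?ln_gt0 ?ltr1n //.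
exact/ln_le0/transition_le1.
Qed.

(** Forgetting the first [n] letters enlarges the event, and stationarity moves it back to time
    0. *)
Lemma prefix_prob_iter_shift P n t x : stationary P ->
  prefix_prob P (n + t) x <= prefix_prob P t (iter n (@shift A) x).
Proof.
move=> sP; rewrite [leRHS]/prefix_prob -(prob_iter_shift n sP (@measurable_cylinder A t _)).
apply: le_prob; first exact: measurable_cylinder.
  apply: (@measurable_determined _ (n + t)).
  exact: (@determined_iter_shift _ _ t n (cylinder _) (@determined_cylinder A t _)).
by move=> y; exact: (@determined_iter_shift _ _ t n _ (@determined_sample A t)).
Qed.

(** Gibbs' inequality against the transition that ignores the oldest letter, whose cross entropy is
    [entropy P t] by stationarity. *)
Lemma entropy_nonincreasing P : stationary P -> nonincreasing_seq (entropy P).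
Proof.
move=> sP; apply/nonincreasing_seqP => t.
have dT := @determined_transition P t.
have [||||le_h _] := @entropy_le_cross P t.+1 (fun x => transition P t (shift x)).
- exact: determined_shift.
- by move=> x; exact: transition_ge0.
- move=> x; rewrite (eq_bigr (fun a => transition P t (set_letter (shift x) t a))).
    exact: sum_transition.
  by move=> a _; rewrite -(iter_shift_set_letter x 1).
- move=> x; rewrite -prefix_prob_gt0 => px.
  by rewrite gt_eqF // transition_gt0 // (lt_le_trans px) // (@prefix_prob_iter_shift P 1).
apply: le_trans le_h _; rewrite entropyE meanN lerN2.
rewrite (@mean_iter_shift _ _ _ 1 _ (fun x => log2 (transition P t x))) //.
exact: (determined_comp (@log2 R) dT).
Qed.

Lemma entropy_rate_le P t : stationary P -> entropy_rate P <= entropy P t.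
Proof.
move=> sP; apply: nonincreasing_cvgn_ge; first exact: entropy_nonincreasing.
apply: nonincreasing_is_cvgn; first exact: entropy_nonincreasing.
by exists 0 => _ [n _ <-]; exact: entropy_ge0.
Qed.

End Entropy.

(** * Distinguishing a stationary ergodic source from a Markov source *)

Section Identity.
Variables (A : alphabetType) (R : realType).
Implicit Types (x y : infseq A) (P Q pi tau : source A R) (f : infseq A -> R).

(** Events determined by a finite prefix are stable under intersection and generate the
    sigma-algebra. *)
Lemma source_eq P Q :
  (forall t (D : set (infseq A)), determined t D -> prob P D = prob Q D) ->
  forall E, measurable E -> P E = Q E.
Proof.
move=> eqPQ; pose G : set (set (infseq A)) := [set D | exists t, determined t D].
apply: (measure_unique G (fun=> setT)).
- apply/seteqP; split=> E.
    apply: smallest_sub; first exact: smallest_sigma_algebra.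
    move=> _ [i [a ->]]; apply: sub_sigma_algebra; exists i.+1 => x y.
    by move=> /sample_eqP /(_ i (leqnn _)) /= ->.
  apply: smallest_sub; first exact: sigma_algebra_measurable.
  by move=> D [t]; exact: measurable_determined.
- move=> D E [s dD] [t dE]; exists (maxn s t) => x y eq_xy.
  rewrite /setI /= (determinedW (leq_maxl s t) dD eq_xy).
  by rewrite (determinedW (leq_maxr s t) dE eq_xy).
- by move=> _; exists 0%N.
- by apply/seteqP; split=> // x _; exists 0%N.
- move=> D [t dD]; have mD := measurable_determined dD.
  exact: etrans (probE P mD) (etrans (congr1 EFin (eqPQ _ _ dD)) (esym (probE Q mD))).
- by move=> _; rewrite (le_lt_trans (probability_le1 P _)) ?ltry.
Qed.

Lemma markov_prefix_prob m pi n x : stationary pi -> markov_property m pi ->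
  prefix_prob pi (n + m).+1 x =
  prefix_prob pi (n + m) x * transition pi m (iter n (@shift A) x).
Proof.
move=> sP mP; rewrite prefix_probS.
have [->|p_neq0] := eqVneq (prefix_prob pi (n + m) x) 0; first by rewrite !mul0r.
congr (_ * _).
have winE t : window x 0 t = cylinder (sample x t).
  apply/seteqP; split=> y; first by move=> xy; apply/sample_eqP => i; exact: xy.
  by move=> /sample_eqP xy i /=; exact: xy.
have pn0 : pi (window x 0 (n + m)) != 0%E.
  rewrite winE (probE pi); last exact: measurable_cylinder.
  by rewrite eqe.
have := mP (n + m)%N x (x (n + m)%N) (leq_addl n m) pn0.
have meetE j k : (j <= k)%N ->
    [set y : infseq A | y k = x k] `&` window x j k = window x j k.+1.
  move=> le_jk; apply/seteqP; split=> y.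
    move=> [yk xy] i /andP[le_ji]; rewrite ltnS leq_eqVlt => /orP[/eqP -> //|lt_ik].
    by apply: xy; rewrite le_ji.
  move=> xy; split; first by apply: xy; rewrite le_jk ltnSn.
  by move=> i /andP[le_ji lt_ik]; apply: xy; rewrite le_ji ltnS ltnW.
(* Stationarity carries a window starting at time [n] back to time 0. *)
have shiftE k : prob pi (window x n (n + k)) =
    prefix_prob pi k (iter n (@shift A) x).
  rewrite [RHS]/prefix_prob -(prob_iter_shift n sP (@measurable_cylinder A k _)).
  congr (prob pi _); apply/funext => y; apply/propext.
  split=> [xy|/sample_eqP xy i /andP[le_ni]].
    apply/sample_eqP => i lt_ik; rewrite !iter_shiftE; apply: xy.
    by rewrite leq_addr ltn_add2l.
  by rewrite -(subnKC le_ni) ltn_add2l => /xy; rewrite !iter_shiftE.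
rewrite /cond_prob !meetE ?leq_addl ?leq_subr // addnK !winE -addnS.
have fE E : fine (pi E) = prob pi E by [].
by rewrite !fE !shiftE addnS.
Qed.

(** Beyond the first [m] letters both sources multiply by the same factors, so only the initial word
    has to be compared. *)
Lemma prefix_prob_dominated m pi tau :
  stationary pi -> markov_property m pi ->
  (forall x, prefix_prob tau m x != 0 -> prefix_prob pi m x != 0) ->
  (forall n x, prefix_prob tau (n + m).+1 x != 0 ->
     transition tau (n + m) x = transition pi m (iter n (@shift A) x)) ->
  exists2 C : R, 0 <= C & forall n x,
    prefix_prob tau (n + m) x <= C * prefix_prob pi (n + m) x.
Proof.
move=> sP mP dom eq_tr.
(* [C] is at least [1 / pi(v)] for every [v] with [pi(v) > 0]; null words add 0. *)
pose C := \sum_(v : m.-tuple A) (prob pi (cylinder v))^-1; exists C.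
  by apply: sumr_ge0 => v _; rewrite invr_ge0 prob_ge0.
have C_ge0 : 0 <= C by apply: sumr_ge0 => v _; rewrite invr_ge0 prob_ge0.
elim=> [|n IHn] x.
  have [->|tx] := eqVneq (prefix_prob tau (0 + m) x) 0.
    by rewrite mulr_ge0 ?prefix_prob_ge0.
  have px := dom x tx; apply: le_trans (prefix_prob_le1 tau _ x) _.
  rewrite -(mulVf px) ler_wpM2r ?prefix_prob_ge0 //.
  rewrite /C (bigD1 (sample x m)) //= lerDl.
  by apply: sumr_ge0 => v _; rewrite invr_ge0 prob_ge0.
rewrite addSn; have [->|tx] := eqVneq (prefix_prob tau (n + m).+1 x) 0.
  by rewrite mulr_ge0 ?prefix_prob_ge0.
rewrite (markov_prefix_prob n x sP mP) prefix_probS eq_tr // mulrA.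
by rewrite ler_wpM2r ?transition_ge0.
Qed.

Lemma prob_dominated m P Q (C : R) :
  (forall n x, prefix_prob Q (n + m) x <= C * prefix_prob P (n + m) x) ->
  forall t (D : set (infseq A)), determined t D -> prob Q D <= C * prob P D.
Proof.
(* Longer words are used so that their length has the form [n + m]. *)
move=> le_QP t D /(determinedW (leq_addr m t)) dD.
rewrite !(prob_determined _ dD) big_distrr /=; apply: ler_sum => u _.
by have := le_QP t (extend u); rewrite /prefix_prob sample_extend.
Qed.

(** Otherwise let [c] separate the means. Averages at most [c] become unlikely under [Q]; averages
    above [c] become unlikely under [P], hence under [Q] by domination. These events are
    complementary, a contradiction. *)
Lemma dominated_mean_le m P Q (C : R) k f :
  stationary P -> ergodic P -> stationary Q -> ergodic Q ->
  (forall n x, prefix_prob Q (n + m) x <= C * prefix_prob P (n + m) x) ->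
  determined k f -> mean Q k f <= mean P k f.
Proof.
move=> sP eP sQ eQ le_QP df; rewrite leNgt; apply/negP => lt_PQ.
pose c := (mean P k f + mean Q k f) / 2.
pose S n x := \sum_(i < n) f (iter i (@shift A) x).
have dS n : determined (n + k) (S n) by exact: determined_birkhoff.
pose F n := [set x | S n x <= c * n%:R].
have dF n : determined (n + k) (F n) by move=> x y /dS; rewrite /F /= => ->.
have mF n := measurable_determined (dF n).
have QF : Q (F n) @[n --> \oo] --> 0%E.
  by apply: (birkhoff_lower_tail sQ eQ df); rewrite /c; lra.
(* The upper tail under [P] is the lower tail for [- f]. *)
have dNf : determined k (fun x => - f x) by move=> x y /df ->.
have PF : P [set x | \sum_(i < n) - f (iter i (@shift A) x) <= - c * n%:R]
    @[n --> \oo] --> 0%E.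
  by apply: (birkhoff_lower_tail sP eP dNf); rewrite meanN /c; lra.
have CF n : prob Q (~` F n) <=
    C * prob P [set x | \sum_(i < n) - f (iter i (@shift A) x) <= - c * n%:R].
  set H := (X in prob P X).
  have dH : determined (n + k) H.
    by move=> x y /dS; rewrite /H /S /= !sumrN => ->.
  apply: le_trans (prob_dominated le_QP dH); apply: le_prob.
  - exact: measurableC.
  - exact: measurable_determined dH.
  - by move=> x /negP; rewrite /H /S /= sumrN mulNr lerN2 -ltNge => /ltW.
have sum1 n : prob Q (F n) + prob Q (~` F n) = 1.
  rewrite /prob -fineD ?fin_num_measure //; last exact: measurableC.
  by rewrite probability_setC // addeC subeK ?fin_num_measure.
have {}QF : prob Q (F n) @[n --> \oo] --> 0 by apply: fine_cvg QF.
have {}PF : prob P [set x | \sum_(i < n) - f (iter i (@shift A) x) <= - c * n%:R]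
    @[n --> \oo] --> 0 by apply: fine_cvg PF.
have : prob Q (F n) + C * prob P [set x | \sum_(i < n) - f (iter i (@shift A) x) <=
    - c * n%:R] @[n --> \oo] --> (0 : R).
  rewrite -[X in _ --> X]addr0 -[X in _ --> _ + X](mulr0 C).
  by apply: cvgD => //; apply: cvgM => //; exact: cvg_cst.
move=> /cvgrPdist_lt /(_ 1 ltr01) [n _ /(_ n (leqnn n))] /=.
by rewrite sub0r normrN => /(le_lt_trans (ler_norm _)); have := CF n; have := sum1 n; lra.
Qed.

End Identity.

(** * Cross entropy and the Type II error *)

Section TypeTwo.
Variables (A : alphabetType) (R : realType).
Implicit Types (x y : infseq A) (pi tau : source A R).

(** The competitor is the order-[m] transition of [pi] read after [n] letters; by stationarity of
    [tau] its cross entropy does not depend on [n]. *)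
Lemma cross_entropy m n pi tau : stationary tau ->
  (forall x, prefix_prob tau m.+1 x != 0 -> prefix_prob pi m.+1 x != 0) ->
  entropy tau (n + m) <= mean tau m.+1 (fun x => - log2 (transition pi m x)) /\
  (mean tau m.+1 (fun x => - log2 (transition pi m x)) <= entropy tau (n + m) ->
   forall x, prefix_prob tau (n + m).+1 x != 0 ->
     transition tau (n + m) x = transition pi m (iter n (@shift A) x)).
Proof.
move=> sT dom; have dT := @determined_transition A R pi m.
have df := determined_comp (fun z : R => - log2 z) dT.
rewrite -(mean_iter_shift n sT df) addnS.
apply: (@entropy_le_cross _ _ _ _ (fun x => transition pi m (iter n (@shift A) x))).
- by rewrite -addnS; exact: determined_iter_shift.
- by move=> x; exact: transition_ge0.
- move=> x; under eq_bigr do rewrite iter_shift_set_letter.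
  exact: sum_transition.
- move=> x; rewrite -prefix_prob_gt0 -addnS => tx.
  rewrite gt_eqF // transition_gt0 // prefix_prob_gt0 dom // -prefix_prob_gt0.
  exact: lt_le_trans tx (prefix_prob_iter_shift n m.+1 x sT).
Qed.

Lemma entropy_rate_lt_cross m pi tau : markov_source m pi ->
  stationary tau -> ergodic tau ->
  (exists2 E : set (infseq A), measurable E & tau E <> pi E) ->
  (forall x, prefix_prob tau m.+1 x != 0 -> prefix_prob pi m.+1 x != 0) ->
  entropy_rate tau < mean tau m.+1 (fun x => - log2 (transition pi m x)).
Proof.
move=> [sP eP mP] sT eT [E mE neq_E] dom; rewrite ltNge; apply/negP => le_rate.
have eq_tr n x : prefix_prob tau (n + m).+1 x != 0 ->
    transition tau (n + m) x = transition pi m (iter n (@shift A) x).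
  apply: (cross_entropy n sT dom).2; apply: le_trans le_rate _.
  exact: entropy_rate_le.
(* A word of [m] letters charged by [tau] has an extension charged by [tau], to which [dom]
   applies. *)
have dom_m x : prefix_prob tau m x != 0 -> prefix_prob pi m x != 0.
  rewrite -sum_prefix_prob; apply: contra_neq => px0.
  apply: big1 => a _; apply/eqP; apply: contraT => /dom.
  rewrite -prefix_prob_gt0 => /lt_le_trans /(_ (prefix_prob_le _ _ (leqnSn m))).
  by rewrite /prefix_prob set_letter_sample -/(prefix_prob pi m x) px0 ltxx.
have [C _ le_C] := prefix_prob_dominated sP mP dom_m eq_tr.
apply: neq_E; apply: source_eq mE => t D dD.
(* Comparing the means of the indicator of [D] and of its opposite gives both inequalities. *)
have dD1 : determined t (fun x => (`[< D x >] : bool)%:R : R).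
  by move=> x y /dD ->.
have dND1 : determined t (fun x => - ((`[< D x >] : bool)%:R : R)).
  by move=> x y /dD ->.
apply/eqP; rewrite eq_le -!(mean_indicator _ dD).
rewrite (dominated_mean_le sP eP sT eT le_C dD1) /= -lerN2 -!meanN.
exact: (dominated_mean_le sP eP sT eT le_C dND1).
Qed.

(** The chain rule, with the nonnegative contribution of the first [m] letters dropped. *)
Lemma log_likelihood m n pi x : stationary pi -> markov_property m pi ->
  prefix_prob pi (n + m) x != 0 ->
  \sum_(i < n) - log2 (transition pi m (iter i (@shift A) x)) <=
  - log2 (prefix_prob pi (n + m) x).
Proof.
move=> sP mP; have ln20 := ln2_gt0 R; elim: n => [|n IHn].
  move=> _; rewrite big_ord0 oppr_ge0 /log2 pmulr_lle0 ?invr_gt0 //.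
  exact/ln_le0/prefix_prob_le1.
rewrite addSn (markov_prefix_prob n x sP mP) mulf_eq0 negb_or => /andP[px tx].
rewrite big_ord_recr /= /log2 lnM ?posrE ?prefix_prob_gt0 //; last first.
  by rewrite lt_def tx transition_ge0.
by rewrite mulrDl opprD lerD2r; exact: IHn.
Qed.

Lemma accepts_prefix_prob pi (alpha : R) (phi : word_map A) t x :
  accepts pi alpha phi (sample x t) ->
  prefix_prob pi t x != 0 /\
  - log2 (prefix_prob pi t x) <= code_length R phi t x - log2 alpha.
Proof.
rewrite /accepts (probE pi); last exact: measurable_cylinder.
rewrite -/(prefix_prob pi t x) /elog2 /code_length.
have ln20 := ln2_gt0 R.
have [->|px] := eqVneq (prefix_prob pi t x) 0.
  by rewrite le0_lneNy // gt0_mulNye ?lte_fin ?invr_gt0.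
rewrite lne_EFin ?prefix_prob_gt0 // -EFinM -EFinN -EFinB lee_fin.
by rewrite -/(log2 _) => le_log; split=> //; lra.
Qed.

(** Samples have length [n + m] because [n] transitions of order [m] span that many letters. *)
Lemma type2_error_cvg0 m pi tau (alpha : R) (phi : word_map A)
    (F : (set (infseq A))^nat) :
  (forall n, measurable (F n)) -> tau (F n) @[n --> \oo] --> 0%E ->
  (\forall n \near \oo, forall x, accepts pi alpha phi (sample x (n + m)) -> F n x) ->
  type2_error pi alpha phi tau t @[t --> \oo] --> 0%E.
Proof.
move=> mF F0 leF.
suff : type2_error pi alpha phi tau (n + m) @[n --> \oo] --> 0%E.
  move=> cvg_m; rewrite -(cvg_shiftn m); exact: cvg_m.
apply: (@squeeze_cvge _ _ _ _ (fun=> 0%E) _ (fun n => tau (F n))) => //.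
- apply: filterS leF => n leF_n; rewrite measure_ge0 /= le_measure ?inE //.
  apply: (@measurable_determined _ (n + m)) => x y eq_xy.
  by rewrite /= eq_xy.
- exact: cvg_cst.
Qed.

Lemma determined_code_length phi t : determined t (@code_length A R phi t).
Proof. by move=> x y; rewrite /code_length => ->. Qed.

Lemma cvg_code_length_tail tau (phi : word_map A) (h c : R) m : h < c ->
  {ae tau, forall x, code_length R phi t x / t%:R @[t --> \oo] --> h} ->
  tau [set x | c * (n + m)%:R <= code_length R phi (n + m) x]
    @[n --> \oo] --> 0%E.
Proof.
move=> lt_hc ae_cvg.
apply: cvg_prob0_lim_sup => [n|].
  apply: (@measurable_determined _ (n + m)) => x y eq_xy /=.
  by rewrite (determined_code_length phi eq_xy).
apply: negligibleS ae_cvg => x infx /= cvgx.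
have /cvgrPdist_lt /(_ (c - h)) := cvgx; rewrite subr_gt0 lt_hc => /(_ isT).
(* [N.+1] makes [n + m] positive, as the division requires. *)
move=> [N _ leN]; have [n /= le_Nn] := infx N.+1 I.
have := leN (n + m)%N (leq_trans (ltnW le_Nn) (leq_addr m n)).
have nm_gt0 : 0 < (n + m)%:R :> R
  by rewrite ltr0n (leq_trans _ (leq_addr m n)) // (leq_trans _ le_Nn).
rewrite /= distrC => /(le_lt_trans (ler_norm _)); rewrite ltrBlDr subrK.
by rewrite ltr_pdivrMr // ltNge => /negbTE ->.
Qed.

Lemma type2_error_singular m pi tau (alpha : R) (phi : word_map A) x0 :
  stationary pi -> stationary tau -> ergodic tau ->
  prefix_prob tau m.+1 x0 != 0 -> prefix_prob pi m.+1 x0 = 0 ->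
  type2_error pi alpha phi tau t @[t --> \oo] --> 0%E.
Proof.
move=> sP sT eT tx0 px0; pose D : set (infseq A) := cylinder (sample x0 m.+1).
pose f x : R := (`[< D x >] : bool)%:R.
have dD : determined m.+1 D by exact: determined_cylinder.
have df : determined m.+1 f by move=> x y /dD eqD; rewrite /f eqD.
have mf : 0 < mean tau m.+1 f.
  by rewrite /f mean_indicator // -/(prefix_prob tau m.+1 x0) prefix_prob_gt0.
have F0 := birkhoff_lower_tail sT eT df mf.
apply: (@type2_error_cvg0 m _ _ _ _ _ _ F0) => [n|].
  apply: (@measurable_determined _ (n + m.+1)) => x y eq_xy /=.
  by rewrite (determined_birkhoff df eq_xy).
(* An accepted sample has positive [pi]-probability, so the excluded word occurs nowhere in it and
   the Birkhoff sum is 0. *)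
apply: nearW => n x /accepts_prefix_prob[px _] /=; rewrite mul0r big1 // => i _.
rewrite /f asboolF // => Dx; move/negP: px; apply.
rewrite eq_le prefix_prob_ge0 andbT -px0.
have le_im : (i + m.+1 <= n + m)%N by rewrite addnS -addSn leq_add2r.
apply: le_trans (prefix_prob_le _ _ le_im) _.
apply: le_trans (prefix_prob_iter_shift i m.+1 x sP) _.
by rewrite /prefix_prob (_ : sample (iter i _ x) _ = sample x0 m.+1).
Qed.

Lemma type2_error_markov m pi tau (alpha : R) (phi : word_map A) :
  markov_source m pi -> stationary tau -> ergodic tau ->
  (exists2 E : set (infseq A), measurable E & tau E <> pi E) ->
  {ae tau, forall x,
     code_length R phi t x / t%:R @[t --> \oo] --> entropy_rate tau} ->
  type2_error pi alpha phi tau t @[t --> \oo] --> 0%E.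
Proof.
move=> mS sT eT neq ae_len; have [sP _ mP] := mS.
have [[x0 [tx0 px0]]|abs] := pselect (exists x, prefix_prob tau m.+1 x != 0 /\
    prefix_prob pi m.+1 x = 0).
  exact: type2_error_singular px0.
have dom x : prefix_prob tau m.+1 x != 0 -> prefix_prob pi m.+1 x != 0.
  by move=> tx; apply/eqP => px; apply: abs; exists x.
have lt_rate := entropy_rate_lt_cross mS sT eT neq dom.
pose f x := - log2 (transition pi m x); rewrite -/f in lt_rate.
have df : determined m.+1 f.
  exact: (determined_comp (fun z : R => - log2 z) (@determined_transition A R pi m)).
pose h := entropy_rate tau; pose H := mean tau m.+1 f.
(* [c1 < c2] cut the gap from [h] to [H] into thirds: code lengths stay below the rate [c1],
   log-likelihoods above [c2]. *)
pose c1 := (2 * h + H) / 3; pose c2 := (h + 2 * H) / 3.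
have lt_hH : h < H by [].
have F0 := birkhoff_lower_tail sT eT df (_ : c2 < _).
have {}F0 := F0 ltac:(by rewrite /c2 -/H; lra).
have G0 := cvg_code_length_tail m (_ : h < c1) ae_len.
have {}G0 := G0 ltac:(by rewrite /c1; lra).
pose F n := [set x | \sum_(i < n) f (iter i (@shift A) x) <= c2 * n%:R].
pose G n := [set x | c1 * (n + m)%:R <= code_length R phi (n + m) x].
have mF n : measurable (F n).
  apply: (@measurable_determined _ (n + m.+1)) => x y eq_xy; rewrite /F /=.
  by rewrite (determined_birkhoff df eq_xy).
have mG n : measurable (G n).
  apply: (@measurable_determined _ (n + m)) => x y eq_xy.
  by rewrite /G /= (determined_code_length phi eq_xy).
apply: (@type2_error_cvg0 m _ _ _ _ (fun n => F n `|` G n)).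
- by move=> n; exact: measurableU.
- apply: (@squeeze_cvge _ _ _ _ (fun=> 0%E) _ (fun n => tau (F n) + tau (G n))%E).
  + by apply: nearW => n; rewrite measure_ge0 /= measureU2.
  + exact: cvg_cst.
  + by rewrite -[X in _ --> X]adde0; apply: cvgeD.
(* Acceptance outside [G n] bounds the sum by [c1 * n + b], which is below [c2 * n] once
   [n > b / (c2 - c1)]. *)
- pose b := c1 * m%:R - log2 alpha.
  exists (Num.truncn (b / (c2 - c1))).+1 => // n /= le_n x.
  move=> /accepts_prefix_prob[px le_len].
  have := log_likelihood sP mP px.
  have [?|lt_len] := lerP (c1 * (n + m)%:R) (code_length R phi (n + m) x); first by right.
  move=> le_sum; left; rewrite /F /=.
  have : b < (c2 - c1) * n%:R.
    have lt_c : 0 < c2 - c1 by rewrite /c1 /c2; lra.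
    rewrite mulrC -ltr_pdivrMr // (lt_le_trans (truncnS_gt _)) //.
    by rewrite ler_nat.
  move: lt_len le_sum; rewrite /b natrD -/(f _); move: (\sum_(i < n) _) => S.
  lra.
Qed.

End TypeTwo.

Theorem theorem6 (A : alphabetType) (R : realType) (pi : source A R) (alpha : R)
    (phi : word_map A) :
  0 < alpha < 1 -> is_code phi ->
  (forall t : nat, (0 < t)%N -> (type1_error pi alpha phi t <= alpha%:E)%E) /\
  (finite_order_source pi -> universal R phi ->
   forall tau : source A R, stationary tau -> ergodic tau ->
     (exists2 E : set (infseq A), measurable E & tau E <> pi E) ->
     type2_error pi alpha phi tau t @[t --> \oo] --> 0%E).
Proof.
move=> /andP[alpha_gt0 _] code; split=> [t|[m mS] univ tau sT eT neq].
  exact: type1_error_le.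
exact: (type2_error_markov alpha mS sT eT neq (univ tau sT eT).1).
Qed.
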